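(* Let $x_0\in\mathrm{dom}\,\psi$, $\Psi_0(x)=\beta(x_0,x)$, and let sequences be generated by the Dual Reduced-Gradient Method: for each $t\ge0$, a) $v_t=\arg\min_{x\in\mathrm{dom}\,\psi}\Psi_t(x)$; b) $x_{t+1}\in\mathrm{dom}\,\psi$ together with $V_\psi(x_{t+1})=V(x_{t+1})+\psi'_{x_{t+1}}$, $\psi'_{x_{t+1}}\in\partial\psi(x_{t+1})$, satisfies $$\langle V_\psi(x_{t+1}),v_t-x_{t+1}\rangle>0\ge\langle V_\psi(x_{t+1}),x^*-x_{t+1}\rangle\quad\forall x^*\in X^*;$$ c) $a_{t+1}=\langle V_\psi(x_{t+1}),v_t-x_{t+1}\rangle/\|V_\psi(x_{t+1})\|_*^2$ and $\Psi_{t+1}(x)=\Psi_t(x)+a_{t+1}[\langle V(x_{t+1}),x-x_{t+1}\rangle+\psi(x)]$. Let $\Psi_t^*=\min_{x\in\mathrm{dom}\,\psi}\Psi_t(x)$, $b_i=\frac{\langle V_\psi(x_i),v_{i-1}-x_i\rangle^2}{2\|V_\psi(x_i)\|_*^2}$ for $i\ge1$, and $B_t=\sum_{i=1}^tb_i$ ($B_0=0$). Then for any $t\ge0$, $$\sum_{i=1}^ta_i\psi(x_i)+B_t\le\Psi_t^*.$$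
   Context: $\mathbb{E}$ is a finite-dimensional real vector space with dual $\mathbb{E}^*$, equipped with an arbitrary norm $\|\cdot\|$; $\|g\|_*=\max\{\langle g,x\rangle:\|x\|\le1\}$. $\psi$ is a proper closed convex function on $\mathbb{E}$ and $V:\mathrm{dom}\,\psi\to\mathbb{E}^*$ is a monotone operator: $\langle V(x)-V(y),x-y\rangle\ge0$ for $x,y\in\mathrm{dom}\,\psi$. $X^*$ is the set of points $x^*\in\mathrm{dom}\,\psi$ with $\langle V(x),x-x^*\rangle+\psi(x)\ge\psi(x^* )$ for all $x\in\mathrm{dom}\,\psi$. $d$ is a differentiable convex prox-function (with $\mathrm{dom}\,\psi\subseteq\mathrm{dom}\,d\subseteq\mathbb{E}$) which is strongly convex with parameter one: $d(y)\ge d(x)+\langle\nabla d(x),y-x\rangle+\frac12\|y-x\|^2$ for $x,y\in\mathrm{dom}\,d$. The Bregman distance is $\beta(x,y)=d(y)-d(x)-\langle\nabla d(x),y-x\rangle$. The minimizers defining $v_t$ are assumed to exist. *)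

(* Defs.v *)
From HB Require Import structures.
From mathcomp Require Import all_boot all_order all_algebra.
From mathcomp Require Import all_classical all_reals all_analysis.

Set Implicit Arguments.
Unset Strict Implicit.
Unset Printing Implicit Defensive.

Import Order.TTheory GRing.Theory Num.Theory numFieldNormedType.Exports.

Local Open Scope classical_set_scope.
Local Open Scope ring_scope.

(* Finite-dimensional normed spaces: the norm [`|x|] is arbitrary and the
   topology is the one it induces. Since the dimension is finite, the dual
   space is the space ['Hom(E, R^o)] of all linear forms, and the pairing
   <g, x> is the application [g x]. *)
#[short(type="normedVectType")]
HB.structure Definition NormedVector (R : numFieldType) :=
  {E of NormedModule R E & Vector R E}.

Section convex_analysis.
Context {R : realType} {E : normedVectType R}.
Implicit Types (f : E -> \bar R) (g : 'Hom(E, R^o)) (x y : E).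

(* The supremum is attained, the unit ball being compact. *)
Definition dual_norm g : R := sup [set g x | x in [set x | `|x| <= 1]].

Definition edom f : set E := [set x | (f x < +oo)%E].

Definition epigraph f : set (E * R^o)%type :=
  [set p | (f p.1 <= (p.2 : R)%:E)%E].

Definition proper_fun f : Prop := (forall x, f x != -oo%E) /\ edom f !=set0.

Definition closed_fun f : Prop := closed (epigraph f).

Definition convex_fun f : Prop := convex_set (epigraph f).

Definition subdifferential f x : set 'Hom(E, R^o) :=
  [set g | edom f x /\ forall y, (f x + (g (y - x))%:E <= f y)%E].

(* [gradf] is a gradient of [f] on its domain. The first-order expansion is
   relative to [edom f], which is not required to be open; at an interior point
   of [edom f] this is ordinary (Frechet) differentiability. *)
Definition gradient_on_dom f (gradf : E -> 'Hom(E, R^o)) : Prop :=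
  forall x, edom f x ->
    (fun y => fine (f y) - fine (f x) - gradf x (y - x) : R^o)
      =o_ (within (edom f) (nbhs x)) (fun y => y - x).

Definition strongly_convex1 f (gradf : E -> 'Hom(E, R^o)) : Prop :=
  forall x y, edom f x -> edom f y ->
    (f x + (gradf x (y - x))%:E + (2^-1 * `|y - x| ^+ 2)%:E <= f y)%E.

Definition bregman f (gradf : E -> 'Hom(E, R^o)) x y : \bar R :=
  (f y - f x - (gradf x (y - x))%:E)%E.

Definition monotone_on (D : set E) (V : E -> 'Hom(E, R^o)) : Prop :=
  forall x y, D x -> D y -> 0 <= (V x - V y) (x - y).

Definition is_argmin (D : set E) f x : Prop :=
  D x /\ forall y, D y -> (f x <= f y)%E.

Definition weak_solutions (psi : E -> \bar R) (V : E -> 'Hom(E, R^o)) : set E :=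
  [set xs | edom psi xs /\
    forall x, edom psi x -> (psi xs <= (V x (x - xs))%:E + psi x)%E].

End convex_analysis.

Section dual_reduced_gradient.
Context {R : realType} {E : normedVectType R}.
Variables (psi : E -> \bar R) (V : E -> 'Hom(E, R^o)).
Variables (d : E -> \bar R) (gradd : E -> 'Hom(E, R^o)).
(* [psi' i] is the subgradient of [psi] selected at [x i]; the values [psi' 0],
   [drg_step 0] and [drg_gain 0] are never used. *)
Variables (x v : nat -> E) (psi' : nat -> 'Hom(E, R^o)).

Definition drg_Vpsi (i : nat) : 'Hom(E, R^o) := V (x i) + psi' i.

(* the coefficients a_i *)
Definition drg_step (i : nat) : R :=
  drg_Vpsi i (v i.-1 - x i) / dual_norm (drg_Vpsi i) ^+ 2.

(* the terms b_i *)
Definition drg_gain (i : nat) : R :=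
  drg_Vpsi i (v i.-1 - x i) ^+ 2 / (2 * dual_norm (drg_Vpsi i) ^+ 2).

Fixpoint drg_Psi (t : nat) : E -> \bar R :=
  if t is s.+1 then fun y =>
    (drg_Psi s y + (drg_step s.+1)%:E * ((V (x s.+1) (y - x s.+1))%:E + psi y))%E
  else bregman d gradd (x 0%N).

(* A minimum: it is attained at [v t] (see [drg_v_argmin] below). *)
Definition drg_Psi_min (t : nat) : \bar R :=
  ereal_inf [set drg_Psi t y | y in edom psi].

Record drg_method : Prop := DrgMethod {
  drg_x_dom : forall t, edom psi (x t) ;
  drg_v_argmin : forall t, is_argmin (edom psi) (drg_Psi t) (v t) ;
  drg_subgradient : forall t, subdifferential psi (x t.+1) (psi' t.+1) ;
  drg_separation : forall t, 0 < drg_Vpsi t.+1 (v t - x t.+1) ;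
  drg_cut : forall t xs, weak_solutions psi V xs ->
    drg_Vpsi t.+1 (xs - x t.+1) <= 0
}.

End dual_reduced_gradient.

(* Main.v *)
Require Import Defs.
From HB Require Import structures.
From mathcomp Require Import all_boot all_order all_algebra.
From mathcomp Require Import all_classical all_reals all_analysis.
From mathcomp Require Import ring lra.

(* The model Psi_t is strongly convex with parameter one on dom psi, so it grows
   quadratically around its minimizer:
     Psi_t(y) >= Psi_t^* + |y - v_t|^2 / 2.
   Bounding psi from below by its subgradient at x_{t+1} and writing
   s = <V_psi(x_{t+1}), v_t - x_{t+1}>, N = |V_psi(x_{t+1})|_*, n = |y - v_t|,
     Psi_{t+1}(y) - a_{t+1} psi(x_{t+1}) >= Psi_t^* + a_{t+1} (s - N n) + n^2 / 2,
   and the step a_{t+1} = s / N^2 maximizes the minimum over n of the last two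
   terms; this minimum is b_{t+1} = s^2 / (2 N^2). *)

Set Implicit Arguments.
Unset Strict Implicit.
Unset Printing Implicit Defensive.

Import Order.TTheory GRing.Theory Num.Theory numFieldNormedType.Exports.

Local Open Scope classical_set_scope.
Local Open Scope ring_scope.

(** * Linear forms on segments and the dual norm *)

Section linear_forms.
Context {R : realType} {E : normedVectType R}.
Implicit Types (g : 'Hom(E, R^o)) (x y z : E).

(** Affine terms satisfy the convexity inequality with equality, so they cancel when strong
    convexity is checked. *)
Lemma hom_segment g y z c (l : R) :
  g (y + l *: (z - y) - c) = (1 - l) * g (y - c) + l * g (z - c) :> R.
Proof.
have -> : y + l *: (z - y) - c = (1 - l) *: (y - c) + l *: (z - c).
  by rewrite scalerBl scale1r -[RHS]addrA [in RHS](addrC (- _)) -scalerBr opprB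
    addrA subrK addrAC.
by rewrite linearD !linearZ.
Qed.

(* If the supremum defining [dual_norm g] is infinite then [dual_norm g] takes
   the default value 0; hence the hypothesis [dual_norm g != 0] suffices. *)
Lemma hom_le_dual_norm g x : dual_norm g != 0 -> g x <= dual_norm g * `|x| :> R.
Proof.
move=> g0; have [->|x0] := eqVneq x 0; first by rewrite linear0 normr0 mulr0.
have nx : 0 < `|x| by rewrite normr_gt0.
have supg : has_sup [set g x | x in [set x | `|x| <= 1]].
  by apply: contrapT => /sup_out g0'; rewrite /dual_norm g0' eqxx in g0.
have /(_ (g (`|x|^-1 *: x)))/= := sup_upper_bound supg.
rewrite -/(dual_norm g) linearZ => h.
rewrite mulrC -ler_pdivrMl //; apply: h.
exists (`|x|^-1 *: x); last by rewrite linearZ.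
by rewrite /= normrZ normfV normr_id mulVf ?gt_eqF.
Qed.

End linear_forms.

(** * Strong convexity along segments and quadratic growth *)

Section strong_convexity.
Context {R : realType} {E : normedVectType R}.
Implicit Types (D : set E) (f : E -> R) (g : 'Hom(E, R^o)) (x y z : E).

Definition segment_closed D : Prop :=
  forall y z (l : R), D y -> D z -> 0 <= l <= 1 -> D (y + l *: (z - y)).

Definition convex_on D f : Prop :=
  forall y z (l : R), D y -> D z -> 0 <= l <= 1 ->
    f (y + l *: (z - y)) <= (1 - l) * f y + l * f z.

Definition strongly_convex_on D f : Prop :=
  forall y z (l : R), D y -> D z -> 0 <= l <= 1 ->
    f (y + l *: (z - y)) + l * (1 - l) * (2^-1 * `|z - y| ^+ 2)
    <= (1 - l) * f y + l * f z.

(* Only the gradient at the intermediate point is used. *)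
Lemma gradient_strongly_convex_on D f (grad : E -> 'Hom(E, R^o)) :
  segment_closed D ->
  (forall x y, D x -> D y ->
    f x + grad x (y - x) + 2^-1 * `|y - x| ^+ 2 <= f y) ->
  strongly_convex_on D f.
Proof.
move=> Dseg fgrad y z l Dy Dz l01; have Dw := Dseg _ _ _ Dy Dz l01.
set w := y + l *: (z - y) in Dw *.
have /andP[l0 l1] := l01.
have yw : y - w = - l *: (z - y) by rewrite /w opprD addrA subrr sub0r scaleNr.
have zw : z - w = (1 - l) *: (z - y) by rewrite /w opprD addrA scalerBl scale1r.
have := fgrad _ _ Dw Dz; have := fgrad _ _ Dw Dy.
rewrite yw zw !linearZ/= !normrZ normrN !ger0_norm ?subr_ge0// => hy hz.
set n := `|z - y| in hy hz *; set p := (grad w (z - y) : R) in hy hz *.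
have {}hy : (1 - l) * (f w + - l * p + 2^-1 * (l * n) ^+ 2) <= (1 - l) * f y.
  by apply: ler_wpM2l => //; rewrite subr_ge0.
have {}hz : l * (f w + (1 - l) * p + 2^-1 * ((1 - l) * n) ^+ 2) <= l * f z.
  exact: ler_wpM2l.
(* Both sides agree: the terms in [p] cancel, and (1 - l) l^2 + l (1 - l)^2 = l (1 - l). *)
apply: le_trans (lerD hy hz); rewrite le_eqVlt; apply/orP; left; apply/eqP.
by field.
Qed.

Lemma strongly_convex_onD D f f' : strongly_convex_on D f -> convex_on D f' ->
  strongly_convex_on D (fun y => f y + f' y).
Proof.
move=> sf cf y z l Dy Dz l01.
have := sf _ _ _ Dy Dz l01; have := cf _ _ _ Dy Dz l01; lra.
Qed.

(** Comparing [v] with v + l (y - v) gives (1 - l) |y - v|^2 / 2 <= f y - f v for 0 < l <= 1.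
    Instead of letting l tend to 0, the proof picks one small l that contradicts a failure of the
    bound. *)
Lemma strongly_convex_on_growth D f v y : segment_closed D ->
  strongly_convex_on D f -> D v -> (forall z, D z -> f v <= f z) -> D y ->
  f v + 2^-1 * `|y - v| ^+ 2 <= f y.
Proof.
move=> Dseg sf Dv vmin Dy; set n2 := `|y - v| ^+ 2.
rewrite leNgt; apply/negP => lt_fy.
have vy := vmin _ Dy.
pose e := f v + 2^-1 * n2 - f y.
have e0 : 0 < e by rewrite /e; lra.
have en : e <= 2^-1 * n2 by rewrite /e; lra.
have n0 : 0 < n2 by lra.
(* With [e] the amount by which the bound fails, this choice makes the loss l n2 / 2 equal to e / 2,
   which is less than [e]. *)
pose l := e / n2.
have ln : l * n2 = e by rewrite /l divfK ?gt_eqF.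
have l0 : 0 < l by rewrite divr_gt0.
have l1 : l <= 2^-1 by rewrite ler_pdivrMr.
have l01 : 0 <= l <= 1 by apply/andP; split; lra.
have h := le_trans (lerD (vmin _ (Dseg _ _ _ Dv Dy l01)) (lexx _))
  (sf _ _ _ Dv Dy l01).
have : l * ((1 - l) * (2^-1 * n2)) <= l * (f y - f v).
  by move: h; rewrite -/n2; lra.
rewrite ler_pM2l // mulrCA mulrBl ln mul1r /e; lra.
Qed.

End strong_convexity.

(** * Convex functions on their domain, and the scalar estimate behind the step size *)

Section method.
Context {R : realType} {E : normedVectType R}.
Implicit Types (psi : E -> \bar R) (V : E -> 'Hom(E, R^o)).

Lemma proper_funE psi y : proper_fun psi -> edom psi y ->
  psi y = (fine (psi y))%:E.
Proof.
by move=> [psiNy _] py; rewrite fineK// fin_numE psiNy lt_eqF.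
Qed.

Lemma convex_fun_segment psi y z (l r s : R) : convex_fun psi ->
  (psi y <= r%:E)%E -> (psi z <= s%:E)%E -> 0 <= l <= 1 ->
  (psi (y + l *: (z - y))%R <= ((1 - l) * r + l * s)%:E)%E.
Proof.
move=> cpsi ry sz /andP[l0 l1].
(* The points are swapped because the weight [l] goes to the first one. *)
have := cpsi (z, s) (y, r) (Itv01 l0 l1) (mem_set sz) (mem_set ry).
rewrite inE /epigraph /= => h.
have -> : y + l *: (z - y) = l *: z + (1 - l) *: y.
  by rewrite scalerBr scalerBl scale1r addrCA addrA.
rewrite [(1 - l) * r + l * s]addrC; apply: h.
Qed.

Lemma convex_fun_edom psi : proper_fun psi -> convex_fun psi ->
  segment_closed (edom psi).
Proof.
move=> ppsi cpsi y z l py pz l01.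
have := @convex_fun_segment _ y z l (fine (psi y)) (fine (psi z)) cpsi.
rewrite -!proper_funE // => /(_ (lexx _) (lexx _) l01) h.
exact: le_lt_trans h (ltry _).
Qed.

Lemma convex_fun_convex_on psi : proper_fun psi -> convex_fun psi ->
  convex_on (edom psi) (fine \o psi).
Proof.
move=> ppsi cpsi y z l py pz l01.
have pw := convex_fun_edom ppsi cpsi py pz l01.
rewrite -lee_fin -(proper_funE ppsi pw).
by apply: convex_fun_segment => //; rewrite -proper_funE.
Qed.

(* For N = 0 the left-hand side is 0, since x / 0 = 0. *)
Lemma drg_gain_le (s N p n : R) : 0 <= s -> (N != 0 -> - p <= N * n) ->
  s ^+ 2 / (2 * N ^+ 2) <= s / N ^+ 2 * (s + p) + 2^-1 * n ^+ 2.
Proof.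
move=> s0; have [->|N0 /(_ isT) pNn] := eqVneq N 0.
  by move=> _; rewrite expr0n mulr0 invr0 !mulr0 mul0r add0r mulr_ge0 ?sqr_ge0.
have : s / N ^+ 2 * - p <= s / N ^+ 2 * (N * n).
  by rewrite ler_wpM2l // divr_ge0 ?sqr_ge0.
have -> : s / N ^+ 2 * (N * n) = s / N * n by field.
have -> : s ^+ 2 / (2 * N ^+ 2) = 2^-1 * (s / N) ^+ 2 by field.
(* Completing the square: q^2 - q n + n^2 / 2 >= q^2 / 2 for q = s / N. *)
have := sqr_ge0 (s / N - n).
have -> : s / N ^+ 2 * (s + p) = (s / N) ^+ 2 - s / N ^+ 2 * - p by field.
rewrite sqrrB; set q := s / N; lra.
Qed.

(** * Growth of the models and the induction on the iterates *)

Section iterates.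
Variables (psi : E -> \bar R) (V : E -> 'Hom(E, R^o)).
Variables (d : E -> \bar R) (gradd : E -> 'Hom(E, R^o)).
Variables (x v : nat -> E) (psi' : nat -> 'Hom(E, R^o)).
Hypotheses (psi_proper : proper_fun psi) (psi_convex : convex_fun psi).
Hypotheses (d_proper : proper_fun d) (dom_psi_d : edom psi `<=` edom d).
Hypothesis d_strong : strongly_convex1 d gradd.
Hypothesis xv_drg : drg_method psi V d gradd x v psi'.

Local Notation D := (edom psi).
Local Notation g := (drg_Vpsi V x psi').
Local Notation a := (drg_step V x v psi').
Local Notation b := (drg_gain V x v psi').
Local Notation Psi := (drg_Psi psi V d gradd x v psi').

Lemma drg_step_ge0 t : 0 <= a t.+1.
Proof. by rewrite divr_ge0 ?sqr_ge0 // ltW // (drg_separation xv_drg). Qed.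

Lemma bregman_fine y z : edom d y -> edom d z ->
  bregman d gradd y z = (fine (d z) - fine (d y) - gradd y (z - y))%:E.
Proof. by move=> dy dz; rewrite /bregman (proper_funE d_proper dy) (proper_funE d_proper dz). Qed.

Lemma strongly_convex1_fine y z : edom d y -> edom d z ->
  fine (d y) + gradd y (z - y) + 2^-1 * `|z - y| ^+ 2 <= fine (d z).
Proof.
move=> dy dz; have := d_strong dy dz.
by rewrite (proper_funE d_proper dy) (proper_funE d_proper dz) lee_fin.
Qed.

Lemma drg_Psi_fin_num t y : D y -> Psi t y \is a fin_num.
Proof.
move=> Dy; elim: t => [|t IHt] /=.
  by rewrite bregman_fine //; apply: dom_psi_d => //; exact: drg_x_dom xv_drg _.
by rewrite fin_numD IHt (proper_funE psi_proper Dy) -EFinD -EFinM.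
Qed.

Lemma fine_drg_PsiS t y : D y -> fine (Psi t.+1 y) =
  fine (Psi t y) + a t.+1 * (V (x t.+1) (y - x t.+1) + fine (psi y)) :> R.
Proof.
move=> Dy /=.
by rewrite (proper_funE psi_proper Dy) -EFinD -EFinM fineD ?drg_Psi_fin_num.
Qed.

(** The initial model is [d] plus an affine function, and each step adds a nonnegative multiple of a
    convex function, so the parameter one is preserved. *)
Lemma drg_Psi_strongly_convex t : strongly_convex_on D (fine \o Psi t).
Proof.
have Dseg := convex_fun_edom psi_proper psi_convex.
have pconv := convex_fun_convex_on psi_proper psi_convex.
elim: t => [|t IHt] y z l Dy Dz l01; have Dw := Dseg _ _ _ Dy Dz l01.
  have dx0 : edom d (x 0) by apply: dom_psi_d; exact: drg_x_dom xv_drg _.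
  have breg w (D_w : D w) := bregman_fine dx0 (dom_psi_d D_w).
  rewrite /= !breg //= hom_segment.
  have := gradient_strongly_convex_on Dseg
    (fun y z Dy Dz => strongly_convex1_fine (dom_psi_d Dy) (dom_psi_d Dz))
    Dy Dz l01.
  lra.
have := IHt _ _ _ Dy Dz l01.
rewrite /= -!/(Psi t.+1 _) !fine_drg_PsiS // hom_segment.
have := ler_wpM2l (drg_step_ge0 t) (pconv _ _ _ Dy Dz l01) => /=.
lra.
Qed.

Lemma drg_Psi_growth t y : D y ->
  fine (Psi t (v t)) + 2^-1 * `|y - v t| ^+ 2 <= fine (Psi t y).
Proof.
have [Dv vmin] := drg_v_argmin xv_drg t.
apply: (strongly_convex_on_growth _ (drg_Psi_strongly_convex t)) => //.
  exact: convex_fun_edom.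
by move=> z Dz; apply: fine_le; rewrite ?drg_Psi_fin_num // vmin.
Qed.

Lemma drg_Psi_lower_bound t y : D y ->
  \sum_(1 <= i < t.+1) a i * fine (psi (x i)) + \sum_(1 <= i < t.+1) b i
  <= fine (Psi t y).
Proof.
elim: t y => [|t IHt] y Dy.
  (* Both sums are empty, and the Bregman distance is nonnegative by strong convexity of [d]. *)
  rewrite !big_geq // addr0 /=.
  have dx0 : edom d (x 0) by apply: dom_psi_d; exact: drg_x_dom xv_drg _.
  rewrite (bregman_fine dx0 (dom_psi_d Dy)) /=.
  have := strongly_convex1_fine dx0 (dom_psi_d Dy).
  have := sqr_ge0 `|y - x 0|; lra.
rewrite !(@big_nat_recr _ _ _ t.+1) //= -/(Psi t.+1 _) fine_drg_PsiS //.
have [Dv _] := drg_v_argmin xv_drg t.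
(* The induction hypothesis is taken at the minimizer [v t], and quadratic growth carries it to
   [y]. *)
have IH := IHt _ Dv; have growth := drg_Psi_growth t Dy.
have Dx := drg_x_dom xv_drg t.+1.
have s_gt0 := drg_separation xv_drg t.
have [_ /(_ y)] := drg_subgradient xv_drg t.
rewrite (proper_funE psi_proper Dx) (proper_funE psi_proper Dy) -EFinD lee_fin.
move=> sub.
have gsplit : g t.+1 (y - x t.+1) =
    V (x t.+1) (y - x t.+1) + psi' t.+1 (y - x t.+1) :> R.
  by rewrite /drg_Vpsi add_lfunE.
have gv : g t.+1 (y - x t.+1) = g t.+1 (v t - x t.+1) + g t.+1 (y - v t) :> R.
  by rewrite -linearD; congr (g _ _); rewrite [RHS]addrC addrA subrK.
have gain : b t.+1 <= a t.+1 * (g t.+1 (v t - x t.+1) + g t.+1 (y - v t))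
                      + 2^-1 * `|y - v t| ^+ 2.
  apply: drg_gain_le; first exact: ltW.
  move=> /(hom_le_dual_norm (v t - y)).
  by rewrite -opprB linearN normrN.
(* The subgradient inequality at [x t.+1], scaled by the nonnegative step, trades [psi y] for
   [psi (x t.+1)] and turns [V] into [g]. *)
have : a t.+1 * (g t.+1 (y - x t.+1) + fine (psi (x t.+1)))
    <= a t.+1 * (V (x t.+1) (y - x t.+1) + fine (psi y)).
  by apply: ler_wpM2l; [exact: drg_step_ge0|rewrite gsplit; lra].
rewrite gv; lra.
Qed.

End iterates.
End method.

Theorem theorem2 (R : realType) (E : normedVectType R)
    (psi : E -> \bar R) (V : E -> 'Hom(E, R^o))
    (d : E -> \bar R) (gradd : E -> 'Hom(E, R^o))
    (x v : nat -> E) (psi' : nat -> 'Hom(E, R^o))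
    (psi_proper : proper_fun psi)
    (psi_closed : closed_fun psi)
    (psi_convex : convex_fun psi)
    (V_monotone : monotone_on (edom psi) V)
    (d_proper : proper_fun d)
    (d_convex : convex_fun d)
    (dom_psi_d : edom psi `<=` edom d)
    (d_gradient : gradient_on_dom d gradd)
    (d_strong : strongly_convex1 d gradd)
    (xv_drg : drg_method psi V d gradd x v psi')
    (t : nat) :
  (\sum_(1 <= i < t.+1) (drg_step V x v psi' i)%:E * psi (x i)
     + (\sum_(1 <= i < t.+1) drg_gain V x v psi' i)%:E
   <= drg_Psi_min psi V d gradd x v psi' t)%E.
Proof.
(* A bound at each [y] of the domain suffices; all values there are finite, so it becomes an
   inequality between reals. *)
apply: le_ereal_inf_tmp => _ [y Dy <-].
have psiE i : psi (x i) = (fine (psi (x i)))%:E.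
  by apply: proper_funE => //; exact: drg_x_dom xv_drg i.
under eq_bigr do rewrite psiE -EFinM.
rewrite sumEFin -EFinD -(fineK (drg_Psi_fin_num _ _ _ xv_drg t Dy)) // lee_fin.
exact: drg_Psi_lower_bound.
Qed.
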